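(* Fix $j\in\mathbb N$, $j\ge1$, and $h\in\{1,2\}$, and let $d\ge2$ if $h=1$, $d\ge3$ if $h=2$. Then the random processes $\underline{\mathbf Y}_d^{h,0}$, $\underline{\mathbf Y}_d^{h,1}$ and $\underline{\mathbf Z}_d^{h,j}$ are identically distributed, in the sense that for every $t>0$ and every $n\ge1$ the conditional distributions of the positions $\underline{\mathbf Y}_d^{h,0}(t)$, $\underline{\mathbf Y}_d^{h,1}(t)$ and $\underline{\mathbf Z}_d^{h,j}(t)$ given $\mathcal N(t)=n$ coincide.
   Context: Setting. A particle starts at the origin of $\mathbb R^d$ and moves with constant speed $c>0$. $\mathcal N(t)$ is the number of changes of direction in $[0,t]$; given $\mathcal N(t)=n$, $n\ge1$, its position is $c\sum_{k=1}^{n+1}\underline{\mathbf V}_k\tau_k$, where $\tau_{n+1}=t-\sum_{k=1}^n\tau_k$, the directions $\underline{\mathbf V}_1,\dots,\underline{\mathbf V}_{n+1}$ are i.i.d. uniformly distributed on the unit sphere of $\mathbb R^d$, and the directions, $\underline\tau_n=(\tau_1,\dots,\tau_n)$ and $\mathcal N(t)$ are independent. Generalized Dirichlet law $GD(\underline{\mathbf a}_n;\underline{\mathbf b}_n)$, $\underline{\mathbf a}_n=(a_1,\dots,a_n)$, $\underline{\mathbf b}_n=(b_1,\dots,b_n)$: the probability distribution on the simplex $S_n=\{(\tau_1,\dots,\tau_n): \tau_k>0\ \forall k,\ \sum_{k=1}^n\tau_k<t\}$ with density proportional to $\prod_{k=1}^n\big[\tau_k^{a_k-1}(t-\sum_{l=1}^k\tau_l)^{b_k-1}\big]$.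 Definition of $\underline{\mathbf Y}_d^{h,i}$, $h\in\{1,2\}$, $i\in\{0,1\}$: the motion above in which, given $\mathcal N(t)=n$, $\underline\tau_n$ has law $GD(\underline{\mathbf a}_n;\underline{\mathbf b}_n)$ with $\underline{\mathbf a}_n=\left(\frac dh-1,\dots,\frac dh-1\right)$ and $\underline{\mathbf b}_n=\left(1,\dots,1,\frac dh-i\right)$. Definition of $\underline{\mathbf Z}_d^{h,j}$, $h\in\{1,2\}$, $j\geq1$: the motion above in which, given $\mathcal N(t)=n$, $\underline\tau_n$ has law $GD(\underline{\mathbf a}_n;\underline{\mathbf b}_n)$ with $\underline{\mathbf a}_n=\left(\frac dh-1,\dots,\frac dh-1\right)$ and: if $j\le n-1$, $b_k=1$ for $k\in\{1,\dots,n-1\}\setminus\{j\}$, $b_j=2$, $b_n=\frac dh-1$; if $j\ge n$, $\underline{\mathbf b}_n=\left(1,\dots,1,\frac dh-1\right)$. *)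

(* Defs.v *)
From HB Require Import structures.
From mathcomp Require Import all_boot all_order all_algebra.
From mathcomp Require Import all_classical all_reals all_analysis.
Set Implicit Arguments.
Unset Strict Implicit.
Unset Printing Implicit Defensive.
Import Order.TTheory GRing.Theory Num.Theory.
Import numFieldNormedType.Exports.
Local Open Scope classical_set_scope.
Local Open Scope ring_scope.

(* R^n is represented by n-tuples, which carry the product sigma-algebra. The
   coordinates are typed in [measurableTypeR R], the copy of R with the Borel
   sigma-algebra on which the library's Lebesgue measure lives. *)
Notation Rn R n := (n.-tuple (measurableTypeR R)).

Section lebesgue_tuple.
Context {R : realType}.

Definition tcons n (p : measurableTypeR R * Rn R n) : Rn R n.+1 :=
  [tuple of p.1 :: p.2].

Definition tuncons n (x : Rn R n.+1) : measurableTypeR R * Rn R n :=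
  (thead x, [tuple of behead x]).

Lemma tconsK n : cancel (@tcons n) (@tuncons n).
Proof. by move=> [a b]; congr pair; apply/val_inj. Qed.

Lemma measurable_tcons n : measurable_fun setT (@tcons n).
Proof. by apply: measurable_cons. Qed.

Lemma measurable_tuncons n : measurable_fun setT (@tuncons n).
Proof.
apply/measurable_fun_pairP; split; first exact: measurable_tnth.
exact: measurable_behead.
Qed.

HB.instance Definition _ n :=
  isMeasurableFun.Build _ _ _ _ (@tcons n) (@measurable_tcons n).

Section step.
Variables (n : nat) (m : {sigma_finite_measure set (Rn R n) -> \bar R}).

Definition cons_measure : set (Rn R n.+1) -> \bar R :=
  pushforward (@lebesgue_measure R \x m)%E (@tcons n).

Let cons_measure0 : cons_measure set0 = 0%E.
Proof. exact: measure0. Qed.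

Let cons_measure_ge0 A : (0 <= cons_measure A)%E.
Proof. exact: measure_ge0. Qed.

Let cons_measure_sigma_additive : semi_sigma_additive cons_measure.
Proof. exact: measure_semi_sigma_additive. Qed.

HB.instance Definition _ := isMeasure.Build _ _ _ cons_measure
  cons_measure0 cons_measure_ge0 cons_measure_sigma_additive.

Let cons_measure_sigma_finite : sigma_finite setT cons_measure.
Proof.
have /sigma_finiteP[F [TF ndF Foo]] := sigma_finiteT (@lebesgue_measure R).
have /sigma_finiteP[G [TG ndG Goo]] := sigma_finiteT m.
exists (fun i => @tuncons n @^-1` (F i `*` G i)).
  rewrite predeqE => x; split=> // _.
  have [i _ Fi] : (\bigcup_i F i) (tuncons x).1 by rewrite -TF.
  have [k _ Gk] : (\bigcup_i G i) (tuncons x).2 by rewrite -TG.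
  exists (maxn i k) => //; split => /=.
    by move: Fi; exact/subsetPset/ndF/leq_maxl.
  by move: Gk; exact/subsetPset/ndG/leq_maxr.
move=> i; have [mF ltF] := Foo i; have [mG ltG] := Goo i; split.
  rewrite -[X in measurable X]setTI.
  by apply: measurable_tuncons => //; exact: measurableX.
rewrite /cons_measure /pushforward -comp_preimage.
rewrite (_ : _ \o _ = id); last by apply/funext => x; exact: tconsK.
by rewrite preimage_id product_measure1E// lte_mul_pinfty// ge0_fin_numE.
Qed.

HB.instance Definition _ :=
  @Measure_isSigmaFinite.Build _ _ _ cons_measure cons_measure_sigma_finite.

End step.

Fixpoint lebesgue n : {sigma_finite_measure set (Rn R n) -> \bar R} :=
  match n with
  | 0 => \d_([tuple] : Rn R 0)
  | n'.+1 => cons_measure (lebesgue n')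
  end.

End lebesgue_tuple.

Section laws.
Context {R : realType}.

Definition enorm d (x : Rn R d) : R :=
  Num.sqrt (\sum_(i < d) (tnth x i : R) ^+ 2).

Definition cone d (A : set (Rn R d)) : set (Rn R d) :=
  [set x | 0 < enorm x < 1 /\ A [tuple (tnth x i : R) / enorm x | i < d]].

(* Normalized surface measure of the unit sphere: the surface measure of A is
   d times the Lebesgue measure of the cone over A, and the factor d cancels. *)
Definition sphere_uniform d (A : set (Rn R d)) : \bar R :=
  (lebesgue d (cone A) / lebesgue d (cone setT))%E.

Definition simplex (t : R) n : set (Rn R n) :=
  [set x | (forall k, 0 < (tnth x k : R)) /\ \sum_(k < n) (tnth x k : R) < t].

Definition GD_weight (t : R) n (a b : 'I_n -> R) (x : Rn R n) : R :=
  \prod_(k < n) ((tnth x k : R) `^ (a k - 1) *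
    (t - \sum_(l < n | (l <= k)%N) (tnth x l : R)) `^ (b k - 1)).

Definition GD (t : R) n (a b : 'I_n -> R) (B : set (Rn R n)) : \bar R :=
  ((\int[lebesgue n]_(x in simplex t (n := n) `&` B) (GD_weight t a b x)%:E) /
   (\int[lebesgue n]_(x in simplex t (n := n)) (GD_weight t a b x)%:E))%E.

End laws.

Section probability_notions.
Context {R : realType} {dO : measure_display} {O : measurableType dO}.
Variable P : probability O R.

(* Only meaningful when 0 < P E. *)
Definition cond_prob (E A : set O) : \bar R := (P (A `&` E) / P E)%E.

Definition mutually_independent (dT : measure_display) (T : measurableType dT)
    (X : nat -> O -> T) :=
  forall (s : seq nat) (A : nat -> set T), uniq s ->
    (forall k, measurable (A k)) ->
    P [set w | forall k, k \in s -> A k (X k w)] =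
    (\prod_(k <- s) P (X k @^-1` A k))%E.

(* Allowing [setT] for A, B or C gives the product rule for the pairs too. *)
Definition independent3 (d1 d2 d3 : measure_display) (T1 : measurableType d1)
    (T2 : measurableType d2) (T3 : measurableType d3)
    (X : O -> T1) (Y : O -> T2) (Z : O -> T3) :=
  forall A B C, measurable A -> measurable B -> measurable C ->
    P (X @^-1` A `&` Y @^-1` B `&` Z @^-1` C) =
    (P (X @^-1` A) * P (Y @^-1` B) * P (Z @^-1` C))%E.

End probability_notions.

(* [direction M k] is the (k+1)-st direction. [duration M t n] is the vector of
   the n times between the changes of direction in [0, t] when there are n of
   them; its law depends on t and n, so there is one vector for each (t, n). *)
Record motion (R : realType) (dO : measure_display) (O : measurableType dO)
    (P : probability O R) (d : nat) := Motion {
  changes : R -> {RV P >-> nat} ;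
  direction : nat -> {RV P >-> Rn R d} ;
  duration : R -> forall n, {RV P >-> Rn R n} ;
  changes0 : forall w, changes 0 w = 0%N ;
  changes_nondecreasing : forall w (s t : R), 0 <= s -> s <= t ->
    (changes s w <= changes t w)%N ;
  direction_uniform : forall k (A : set (Rn R d)), measurable A ->
    P (direction k @^-1` A) = sphere_uniform A ;
  direction_independent : mutually_independent P (fun k => direction k) ;
  motion_independent : forall (t : R) n, 0 < t -> (1 <= n)%N ->
    independent3 P (fun w => [tuple direction k w | k < n.+1])
      (duration t n) (changes t)
}.

Section motions.
Context {R : realType} {dO : measure_display} {O : measurableType dO}.
Context {P : probability O R} {d : nat}.
Implicit Type M : motion P d.

Definition all_durations (t : R) n (tau : Rn R n) : seq R :=
  rcons tau (t - \sum_(k < n) (tnth tau k : R)).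

Definition position (c : R) M (t : R) (w : O) : Rn R d :=
  let n := changes M t w in
  [tuple c * \sum_(k < n.+1) (tnth (direction M k w) i : R) *
             (all_durations t (duration M t n w))`_k | i < d].

Definition has_GD_durations M (a b : forall n, 'I_n -> R) :=
  forall (t : R) n, 0 < t -> (1 <= n)%N ->
    (0 < P (changes M t @^-1` [set n]))%E ->
    forall B : set (Rn R n), measurable B ->
      cond_prob P (changes M t @^-1` [set n]) (duration M t n @^-1` B) =
      GD t (a n) (b n) B.

(* The ordinal k : 'I_n stands for the (k+1)-st coordinate. *)
Definition is_Y (h i : nat) M :=
  has_GD_durations M
    (fun n _ => d%:R / h%:R - 1)
    (fun n k => if k.+1 == n then d%:R / h%:R - i%:R else 1).

Definition is_Z (h j : nat) M :=
  has_GD_durations M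
    (fun n _ => d%:R / h%:R - 1)
    (fun n k =>
       if k.+1 == n then d%:R / h%:R - 1
       else if (j <= n.-1)%N && (k.+1 == j) then 2 else 1).

End motions.

Definition same_conditional_positions (R : realType) (c : R) (d : nat)
    (d1 d2 : measure_display) (O1 : measurableType d1) (O2 : measurableType d2)
    (P1 : probability O1 R) (P2 : probability O2 R)
    (M1 : motion P1 d) (M2 : motion P2 d) :=
  forall (t : R) n, 0 < t -> (1 <= n)%N ->
    (0 < P1 (changes M1 t @^-1` [set n]))%E ->
    (0 < P2 (changes M2 t @^-1` [set n]))%E ->
    forall A : set (Rn R d), measurable A ->
      cond_prob P1 (changes M1 t @^-1` [set n]) (position c M1 t @^-1` A) =
      cond_prob P2 (changes M2 t @^-1` [set n]) (position c M2 t @^-1` A).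

(* Main.v *)
Require Import Defs.
From HB Require Import structures.
From mathcomp Require Import all_boot all_order all_algebra.
From mathcomp Require Import all_classical all_reals all_analysis.
From mathcomp Require Import fingroup perm measurable_realfun ring.
Set Implicit Arguments.
Unset Strict Implicit.
Unset Printing Implicit Defensive.
Import Order.TTheory GRing.Theory Num.Theory.
Import numFieldNormedType.Exports.
Local Open Scope classical_set_scope.
Local Open Scope ring_scope.

(* The weights of the three generalized Dirichlet laws are, on the simplex, a
   positive constant times w * (sum of the intervals with index in K), where w
   is the weight of the symmetric Dirichlet law of the n + 1 intervals: K is
   {n + 1}, the set of all indices (their sum is t), or {j + 1, ..., n + 1}.
   For fixed directions, exchanging tau_k with tau_{n+1} = t - sum tau preserves
   Lebesgue measure and w, and amounts to exchanging the k-th and last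
   directions, which leaves their joint law unchanged. Hence biasing w by any of
   the intervals gives the same integral over directions and durations, and the
   conditional law of the position depends neither on K nor on the constant. *)

(** * Invariance of Lebesgue measure under exchange with the last interval *)

Section lebesgue_integrals.
Context {R : realType}.
Local Notation leb := (@lebesgue_measure R).

Lemma measurable_fun_reflect (b : R) :
  measurable_fun setT ((fun a => b - a) : measurableTypeR R -> measurableTypeR R).
Proof. exact: measurable_funB. Qed.

(** The preimage of ]u, v] is [b - v, b - u[, of the same length, and Lebesgue measure is determined
    by its values on half-open intervals. *)
Lemma lebesgue_measure_reflect (b : R) (A : set (measurableTypeR R)) :
  measurable A ->
  pushforward leb ((fun a => b - a) : measurableTypeR R -> measurableTypeR R) A
  = leb A.
Proof.
have mphi := measurable_fun_reflect b.
move=> mA; apply/esym/lebesgue_measure_unique => //= _ [[u v]] _ <-.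
rewrite /pushforward/= (_ : _ @^-1` _ = `[b - v, b - u[%classic); last first.
  apply/seteqP; split => x /=; rewrite !in_itv/=.
    by rewrite ltrBrDl -ltrBrDr lerBlDl -lerBlDr => /andP[-> ->].
  by rewrite ltrBrDl -ltrBrDr lerBlDl -lerBlDr => /andP[-> ->].
rewrite !lebesgue_measure_itv/= !lte_fin ltrD2l ltrN2.
by case: ifP => // _; congr EFin; ring.
Qed.

Lemma ge0_integral_reflect (b : R) (f : R -> \bar R) :
  measurable_fun setT (f : measurableTypeR R -> \bar R) ->
  (forall a, (0 <= f a)%E) ->
  (\int[leb]_a f (b - a)%R = \int[leb]_a f a)%E.
Proof.
move=> mf f0; have mphi := measurable_fun_reflect b.
have := ge0_integral_pushforward mphi leb measurableT mf (fun a _ => f0 a).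
rewrite preimage_setT => <-; apply: eq_measure_integral => A mA _.
exact: lebesgue_measure_reflect.
Qed.

Section cons.
Variables (n : nat) (f : Rn R n.+1 -> \bar R).
Hypotheses (mf : measurable_fun setT f) (f0 : forall x, (0 <= f x)%E).

Let mfc : measurable_fun setT (f \o @tcons R n).
Proof. by apply: measurableT_comp => //; exact: measurable_tcons. Qed.

(** Tonelli in both orders: this one lets the induction act on the tail for a fixed head, while
    [integral_lebesgue_consr] lets a reflection act on the head for a fixed tail. *)
Lemma integral_lebesgue_consl :
  (\int[lebesgue n.+1]_x f x =
   \int[leb]_a \int[lebesgue n]_y f (tcons (a, y)))%E.
Proof.
rewrite /= /cons_measure (ge0_integral_pushforward (@measurable_tcons R n))//.
exact: (fubini_tonelli1 (f \o @tcons R n) mfc (fun z => f0 _)).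
Qed.

Lemma integral_lebesgue_consr :
  (\int[lebesgue n.+1]_x f x =
   \int[lebesgue n]_y \int[leb]_a f (tcons (a, y)))%E.
Proof.
rewrite /= /cons_measure (ge0_integral_pushforward (@measurable_tcons R n))//.
exact: (fubini_tonelli2 (f \o @tcons R n) mfc (fun z => f0 _)).
Qed.

End cons.

(** The last interval is implicit in x, so overwriting the k-th coordinate by it is a full exchange:
    the new last interval is the old k-th one. *)
Definition swap_last (t : R) n (k : 'I_n) (x : Rn R n) : Rn R n :=
  [tuple if i == k then t - \sum_(l < n) (tnth x l : R) else tnth x i | i < n].

Lemma measurable_sum_tnth (t : R) n :
  measurable_fun setT (fun x : Rn R n => t - \sum_(l < n) (tnth x l : R)).
Proof.
by apply: measurable_funB => //; apply: measurable_sum => i; exact: measurable_tnth.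
Qed.

Lemma measurable_swap_last (t : R) n (k : 'I_n) :
  measurable_fun setT (swap_last t k).
Proof.
apply/measurable_fun_tnthP => i.
rewrite (_ : _ \o _ =
  fun x => if i == k then t - \sum_(l < n) (tnth x l : R) else tnth x i); last first.
  by apply/funext => x /=; rewrite tnth_mktuple.
case: (i == k); [|exact: measurable_tnth].
exact: measurable_sum_tnth.
Qed.

Lemma swap_last0 (t : R) n a (y : Rn R n) :
  swap_last t ord0 (tcons (a, y)) =
  tcons (t - \sum_(l < n) (tnth y l : R) - a, y).
Proof.
apply: eq_from_tnth => i; rewrite tnth_mktuple.
case: (unliftP ord0 i) => [j|] ->.
  by rewrite /= !tnthS.
rewrite eqxx big_ord_recl /= !tnth0.
by under eq_bigr do rewrite tnthS; rewrite /=; ring.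
Qed.

Lemma swap_lastS (t : R) n k a (y : Rn R n) :
  swap_last t (lift ord0 k) (tcons (a, y)) = tcons (a, swap_last (t - a) k y).
Proof.
apply: eq_from_tnth => i; rewrite tnth_mktuple.
case: (unliftP ord0 i) => [j|] ->.
  rewrite (inj_eq lift_inj) /= !tnthS tnth_mktuple; case: ifP => // _.
  rewrite big_ord_recl /= !tnth0.
  by under eq_bigr do rewrite tnthS; rewrite /=; ring.
by rewrite /= !tnth0.
Qed.

(** Induction on n with t generalised. If k is not the first coordinate, fixing the first one at a
    leaves the same exchange with t - a in place of t. If k is the first, then for a fixed tail y
    the map is the reflection sending a to (t - sum y) - a. *)
Lemma integral_swap_last (t : R) n (k : 'I_n) (f : Rn R n -> \bar R) :
  measurable_fun setT f -> (forall x, (0 <= f x)%E) ->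
  (\int[lebesgue n]_x f (swap_last t k x) = \int[lebesgue n]_x f x)%E.
Proof.
elim: n t k f => [t []//|n IHn t k f mf f0].
have mfs : measurable_fun setT (f \o swap_last t k).
  by apply: measurableT_comp => //; exact: measurable_swap_last.
case: (unliftP ord0 k) mfs => [j|] -> mfs.
  rewrite (integral_lebesgue_consl mf f0).
  apply: etrans (integral_lebesgue_consl mfs (fun=> f0 _)) _.
  apply: eq_integral => a _.
  under eq_integral do rewrite /= swap_lastS.
  apply: (IHn (t - a) j (fun y => f (tcons (a, y)))) => //.
  apply: measurableT_comp => //.
  by apply: measurableT_comp; [exact: measurable_tcons|exact: pair1_measurable].
rewrite (integral_lebesgue_consr mf f0).
apply: etrans (integral_lebesgue_consr mfs (fun=> f0 _)) _.
apply: eq_integral => y _.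
under eq_integral do rewrite /= swap_last0.
apply: (@ge0_integral_reflect _ (fun a => f (tcons (a, y)))) => //.
apply: measurableT_comp => //.
by apply: measurableT_comp; [exact: measurable_tcons|exact: pair2_measurable].
Qed.

End lebesgue_integrals.

(** * Uniqueness of finite measures on tuples from their values on boxes *)

Section box.
Context {d : measure_display} {T : measurableType d} {R : realType} {n : nat}.

Definition box (A : 'I_n -> set T) : set (n.-tuple T) :=
  [set x | forall i, A i (tnth x i)].

Lemma measurable_box (A : 'I_n -> set T) :
  (forall i, measurable (A i)) -> measurable (box A).
Proof.
move=> mA; rewrite (_ : box A = \bigcap_(i in setT) ((@tnth n T)^~ i @^-1` A i)).
  apply: fin_bigcap_measurable => // i _.
  by rewrite -[X in measurable X]setTI; exact: measurable_tnth.
by apply/seteqP; split => [x xA i _|x xA i]; exact: xA.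
Qed.

(** Boxes are stable under intersection, contain the whole space and generate the product
    sigma-algebra. *)
Lemma tuple_measure_unique (m1 m2 : {finite_measure set (n.-tuple T) -> \bar R}) :
  (forall A : 'I_n -> set T, (forall i, measurable (A i)) ->
     m1 (box A) = m2 (box A)) ->
  forall E, measurable E -> m1 E = m2 E.
Proof.
move=> m12 E mE.
pose G := [set box A | A in [set A | forall i, measurable (A i)]].
have GT : G setT.
  by exists (fun=> setT) => //; apply/seteqP; split.
apply: (measure_unique G (fun=> setT)) => //.
- apply/seteqP; split.
    apply: smallest_sub; first exact: smallest_sigma_algebra.
    rewrite -bigcup_seq => _ [i _ [A mA <-]]; apply: sub_sigma_algebra.
    (* A generator constrains a single coordinate i, so it is the box whose other sides are
       [setT]. *)
    exists (fun j => if j == i then A else setT) => [j|]; first by case: eqP.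
    rewrite setTI; apply/seteqP; split => [x /(_ i)|x Ax j]; first by rewrite eqxx.
    by case: eqP => [->|].
  apply: smallest_sub; first exact: sigma_algebra_measurable.
  by move=> _ [A mA <-]; exact: measurable_box.
- move=> _ _ [A mA <-] [B mB <-]; exists (fun i => A i `&` B i).
    by move=> i; exact: measurableI.
  apply/seteqP; split => [x xAB|x [xA xB] i]; last by split.
  by split => i; have [] := xAB i.
- by rewrite bigcup_const.
- by move=> _ [A mA <-]; exact: m12.
- by move=> _; rewrite -ge0_fin_numE// fin_num_measure.
Qed.

End box.

(** * Conditional probabilities under independence *)

Section independence.
Context {R : realType} {dO : measure_display} {O : measurableType dO}.
Variable P : probability O R.
Context {d1 d2 d3 : measure_display} {T1 : measurableType d1}.
Context {T2 : measurableType d2} {T3 : measurableType d3}.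
Variables (X : {mfun O >-> T1}) (Y : {mfun O >-> T2}) (Z : {mfun O >-> T3}).
Hypothesis XYZ : independent3 P X Y Z.

Lemma cond_prob_independent (B : set T2) (C : set T3) :
  measurable B -> measurable C -> (0 < P (Z @^-1` C))%E ->
  cond_prob P (Z @^-1` C) (Y @^-1` B) = P (Y @^-1` B).
Proof.
move=> mB mC C0; have := XYZ measurableT mB mC.
rewrite /cond_prob preimage_setT setTI probability_setT mul1e => ->.
rewrite -muleA divee ?mule1 ?gt_eqF// fin_num_measure//.
exact: measurable_funPTI.
Qed.

(** The left side is a measure in E which, by independence, factorises on rectangles; hence it is
    the product of the laws of X and Y. The integrand stays conditional because the law of the
    durations is prescribed only given the number of changes. *)
Lemma cond_prob_pair (E : set (T1 * T2)) (C : set T3) :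
  measurable E -> measurable C -> (0 < P (Z @^-1` C))%E ->
  cond_prob P (Z @^-1` C) [set w | E (X w, Y w)] =
  (\int[distribution P X]_x
    cond_prob P (Z @^-1` C) (Y @^-1` xsection E x))%E.
Proof.
move=> mE mC C0.
(* By independence of Y and Z the conditioning drops from the integrand, and the right side becomes
   the product measure of E. *)
under eq_integral => x _ do
  rewrite (cond_prob_independent (measurable_xsection x mE) mC C0).
have mZC : measurable (Z @^-1` C).
  exact: measurable_funPTI.
have mXY : measurable_fun setT (fun w => (X w, Y w)).
  exact: measurable_fun_pair.
(* [mscale] takes a nonnegative real, so the division by the probability of the condition uses the
   real inverse of its finite value. *)
have p0 : 0 <= (fine (P (Z @^-1` C)))^-1 by rewrite invr_ge0 fine_ge0.
pose m : {measure set (T1 * T2) -> \bar R} :=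
  mscale (NngNum p0) (pushforward (mrestr P mZC) (fun w => (X w, Y w))).
have mE' F : m mXY F = cond_prob P (Z @^-1` C) [set w | F (X w, Y w)].
  rewrite /m /= /mscale /= /pushforward /mrestr /cond_prob muleC.
  congr (_ * _)%E; rewrite -[in RHS](@fineK _ (P (Z @^-1` C))) ?fin_num_measure//.
  by rewrite inver gt_eqF// fine_gt0// C0 ltey_eq fin_num_measure.
rewrite -mE'; apply/esym/(@product_measure_unique _ _ _ _ _
  (distribution P X) (distribution P Y)) => //.
move=> A B mA mB; rewrite mE' /cond_prob.

rewrite (_ : _ `&` _ = X @^-1` A `&` Y @^-1` B `&` Z @^-1` C)// XYZ//.
by rewrite -muleA divee ?mule1 ?gt_eqF// fin_num_measure.
Qed.

End independence.

(** * Joint law of the directions and its exchangeability *)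

Section directions.
Context {R : realType} {d : nat}.

Definition directions {dO} {O : measurableType dO} {P : probability O R}
    (M : motion P d) n (w : O) : n.-tuple (Rn R d) :=
  [tuple direction M k w | k < n].

Lemma measurable_directions {dO} {O : measurableType dO} {P : probability O R}
    (M : motion P d) n : measurable_fun setT (directions M n).
Proof.
apply/measurable_fun_tnthP => i.
rewrite (_ : _ \o _ = direction M i)//.
by apply/funext => w /=; rewrite tnth_mktuple.
Qed.

HB.instance Definition _ {dO} {O : measurableType dO} {P : probability O R}
    (M : motion P d) n :=
  isMeasurableFun.Build _ _ _ _ (directions M n) (@measurable_directions _ _ _ M n).

Lemma distribution_directions_box {dO} {O : measurableType dO}
    {P : probability O R} (M : motion P d) n (A : 'I_n -> set (Rn R d)) :
  (forall i, measurable (A i)) ->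
  distribution P (directions M n) (box A) =
  (\prod_(i < n) sphere_uniform (A i))%E.
Proof.
(* Independence is stated for families indexed by all naturals, so A is extended by [setT] beyond
   n. *)
move=> mA; pose B k := if insub k is Some i then A i else setT.
have BA (i : 'I_n) : B i = A i.
  rewrite /B insubT//= => lti.
  by congr A; exact/val_inj.
have mB k : measurable (B k) by rewrite /B; case: insubP.
have := @direction_independent _ _ _ _ _ M (index_iota 0 n) B (iota_uniq _ _) mB.
rewrite big_mkord => MB.
transitivity (\prod_(k < n) P (direction M k @^-1` B k))%E; last first.
  by apply: eq_bigr => i _; rewrite direction_uniform// BA.
rewrite -MB; congr (P _); apply/seteqP; split => [w /= wA k|w /= wB i].
  rewrite mem_index_iota => /= ltk; rewrite (BA (Ordinal ltk)).
  by have := wA (Ordinal ltk); rewrite tnth_mktuple.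
by rewrite tnth_mktuple -BA; apply: wB; rewrite mem_index_iota /=.
Qed.

Lemma distribution_directions_unique {d1 d2} {O1 : measurableType d1}
    {O2 : measurableType d2} {P1 : probability O1 R} {P2 : probability O2 R}
    (M1 : motion P1 d) (M2 : motion P2 d) n (E : set (n.-tuple (Rn R d))) :
  measurable E ->
  distribution P1 (directions M1 n) E = distribution P2 (directions M2 n) E.
Proof.
apply: tuple_measure_unique => A mA.
exact: etrans (distribution_directions_box M1 mA)
  (esym (distribution_directions_box M2 mA)).
Qed.

Definition permute_tuple (T : Type) n (s : {perm 'I_n})
    (v : n.-tuple T) : n.-tuple T :=
  [tuple tnth v (s i) | i < n].

Lemma measurable_permute_tuple d' (T : measurableType d') n (s : {perm 'I_n}) :
  measurable_fun setT (@permute_tuple T n s).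
Proof.
apply/measurable_fun_tnthP => i.
rewrite (_ : _ \o _ = (@tnth n T)^~ (s i)); first exact: measurable_tnth.
by apply/funext => w /=; rewrite tnth_mktuple.
Qed.

Lemma permute_tuple_box d' (T : measurableType d') n (s : {perm 'I_n})
    (A : 'I_n -> set T) :
  @permute_tuple T n s @^-1` box A = box (fun i => A ((s^-1)%g i)).
Proof.
apply/seteqP; split => v vA i /=.
  by have := vA ((s^-1)%g i); rewrite tnth_mktuple permKV.
by have := vA (s i); rewrite permK tnth_mktuple.
Qed.

(** The directions are exchangeable: permuting them permutes the sides of a box, and the product of
    their [sphere_uniform] values is symmetric. *)
Lemma distribution_directions_permute {dO} {O : measurableType dO}
    {P : probability O R} (M : motion P d) n (s : {perm 'I_n})
    (E : set (n.-tuple (Rn R d))) : measurable E ->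
  pushforward (distribution P (directions M n)) (permute_tuple s) E =
  distribution P (directions M n) E.
Proof.
have ms := @measurable_permute_tuple _ (Rn R d) n s.
(* Packing the permutation as a measurable function makes the pushforward a [distribution], hence a
   finite measure. *)
pose S : {mfun n.-tuple (Rn R d) >-> n.-tuple (Rn R d)} :=
  HB.pack (@permute_tuple (Rn R d) n s) (isMeasurableFun.Build _ _ _ _ _ ms).
apply: (@tuple_measure_unique _ _ _ _
  (distribution (distribution P (directions M n)) S)) => A mA.
have mAs i : measurable (A ((s^-1)%g i)) by [].
apply: etrans (esym (distribution_directions_box M mA)).
apply: etrans (_ : distribution P (directions M n)
  (box (fun i => A ((s^-1)%g i))) = _); first by rewrite -permute_tuple_box.
rewrite (distribution_directions_box M mAs).
by rewrite [RHS](reindex_inj (@perm_inj _ (s^-1)%g)).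
Qed.

End directions.

(** * The n + 1 intervals between changes of direction, treated symmetrically *)

Section intervals.
Context {R : realType}.
Variables (t : R) (n : nat).
Implicit Types (x : Rn R n) (k : 'I_n) (i : 'I_n.+1).

Definition time_interval x i : R := (all_durations t x)`_i.

Lemma time_interval_widen x k :
  time_interval x (widen_ord (leqnSn n) k) = tnth x k.
Proof.
by rewrite /time_interval /all_durations nth_rcons size_tuple/= ltn_ord -tnth_nth.
Qed.

Lemma time_interval_max x :
  time_interval x ord_max = t - \sum_(k < n) (tnth x k : R).
Proof. by rewrite /time_interval /all_durations nth_rcons size_tuple/= ltnn eqxx. Qed.

Lemma ord_widen_max (Q : 'I_n.+1 -> Prop) :
  (forall k, Q (widen_ord (leqnSn n) k)) -> Q ord_max -> forall i, Q i.
Proof.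
move=> Qw Qm i; case: (unliftP ord_max i) => [k|] -> //.
rewrite (_ : lift _ _ = widen_ord (leqnSn n) k)//.
by apply/val_inj; rewrite /= /bump leqNgt ltn_ord.
Qed.

Lemma measurable_time_interval i :
  measurable_fun setT (time_interval ^~ i : Rn R n -> R).
Proof.
move: i; apply: ord_widen_max => [k|].
  under eq_fun do rewrite time_interval_widen; exact: measurable_tnth.
under eq_fun do rewrite time_interval_max; exact: measurable_sum_tnth.
Qed.

Lemma sum_time_interval x : \sum_i time_interval x i = t.
Proof.
rewrite big_ord_recr /= time_interval_max.
by under eq_bigr do rewrite time_interval_widen; rewrite addrC subrK.
Qed.

(** All intervals add up to t, so removing the first ones leaves the later ones. The factors of
    [GD_weight] thereby become powers of sums of intervals. *)
Lemma sum_time_interval_gt x k :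
  t - \sum_(l < n | (l <= k)%N) (tnth x l : R) =
  \sum_(i < n.+1 | (k < i)%N) time_interval x i.
Proof.
rewrite -[in LHS](sum_time_interval x) (bigID (fun i => (k < i)%N)) /=.
suff -> : \sum_(i < n.+1 | ~~ (k < i)%N) time_interval x i =
    \sum_(l < n | (l <= k)%N) (tnth x l : R) by rewrite addrK.
rewrite big_mkcond big_ord_recr /= ltn_ord addr0 [RHS]big_mkcond /=.
by apply: eq_bigr => l _; rewrite -leqNgt time_interval_widen.
Qed.

Lemma simplexP x : simplex t x <-> forall i, 0 < time_interval x i.
Proof.
split => [[x0 xt]|x0].
  apply: ord_widen_max => [k|]; first by rewrite time_interval_widen.
  by rewrite time_interval_max subr_gt0.
split => [k|]; first by rewrite -time_interval_widen.
by have := x0 ord_max; rewrite time_interval_max subr_gt0.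
Qed.

Lemma measurable_simplex : measurable (simplex t (n := n)).
Proof.
rewrite (_ : simplex t (n := n) =
  \bigcap_(i in setT) ((time_interval ^~ i : Rn R n -> R) @^-1` `]0, +oo[)).
  apply: fin_bigcap_measurable => // i _.
  by rewrite -[X in measurable X]setTI; exact: measurable_time_interval.
apply/seteqP; split => x.
  by move=> /simplexP x0 i _ /=; rewrite in_itv/= x0.
by move=> x0; apply/simplexP => i; have /= := x0 i I; rewrite in_itv/= andbT.
Qed.

Definition last_tperm k : {perm 'I_n.+1} := tperm (widen_ord (leqnSn n) k) ord_max.

Lemma time_interval_swap_last k x i :
  time_interval (swap_last t k x) i = time_interval x (last_tperm k i).
Proof.
move: i; apply: ord_widen_max => [l|].
  rewrite time_interval_widen tnth_mktuple; case: eqVneq => [->|lk].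
    by rewrite tpermL time_interval_max.
  by rewrite tpermD ?time_interval_widen// -val_eqE/= ?(gtn_eqF (ltn_ord l))// eq_sym.
rewrite time_interval_max tpermR time_interval_widen.
(* With S the sum of the coordinates other than k, the new last interval is t - ((t - (tau_k + S)) +
   S) = tau_k. *)
rewrite (bigD1 k) //= tnth_mktuple eqxx [in X in t - (t - X + _)](bigD1 k) //=.
suff -> : \sum_(i < n | i != k) (tnth (swap_last t k x) i : R) =
    \sum_(i < n | i != k) (tnth x i : R) by ring.
by apply: eq_bigr => l /negPf lk; rewrite tnth_mktuple lk.
Qed.

End intervals.

(** * The position as a function of directions and durations *)

Section endpoint.
Context {R : realType} {d : nat}.
Variables (c t : R) (n : nat).

Definition endpoint (v : n.+1.-tuple (Rn R d)) (x : Rn R n) : Rn R d :=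
  [tuple c * \sum_(k < n.+1) (tnth (tnth v k) i : R) * time_interval t x k | i < d].

Lemma measurable_endpoint :
  measurable_fun setT (fun z : n.+1.-tuple (Rn R d) * Rn R n => endpoint z.1 z.2).
Proof.
apply/measurable_fun_tnthP => i.
rewrite (_ : _ \o _ = fun z : n.+1.-tuple (Rn R d) * Rn R n =>
  c * \sum_(k < n.+1) (tnth (tnth z.1 k) i : R) * time_interval t z.2 k); last first.
  by apply/funext => z /=; rewrite tnth_mktuple.
have mc : measurable_fun setT
  (fun z : n.+1.-tuple (Rn R d) * Rn R n =>
  c * \sum_(k < n.+1) (tnth (tnth z.1 k) i : R) * time_interval t z.2 k).
  apply: measurable_funM => //; apply: measurable_sum => k.
  apply: measurable_funM.
    apply: (@measurableT_comp _ _ _ _ _ _ (fun y : Rn R d => tnth y i : R)).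
      exact: measurable_tnth.
    apply: (@measurableT_comp _ _ _ _ _ _
      (fun y : n.+1.-tuple (Rn R d) => tnth y k)) => //; exact: measurable_tnth.
  exact: measurableT_comp (@measurable_time_interval R t n k) _.
exact: mc.
Qed.

(** The sum pairs each direction with its interval, so a transposition of the intervals can be moved
    to the directions by reindexing. *)
Lemma endpoint_swap_last k v x :
  endpoint v (swap_last t k x) = endpoint (permute_tuple (last_tperm k) v) x.
Proof.
apply: eq_from_tnth => i; rewrite !tnth_mktuple; congr (_ * _).
rewrite [RHS](reindex_inj (@perm_inj _ (last_tperm k))); apply: eq_bigr => l _.
by rewrite time_interval_swap_last tnth_mktuple /last_tperm tpermK.
Qed.

End endpoint.

(** Cancels constants in quotients of integrals for an arbitrary extended real y, so the normalising
    integral never has to be evaluated. *)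
Lemma mule_divM2l (R : realFieldType) (r : R) (x y : \bar R) :
  0 < r -> (r%:E * x / (r%:E * y) = x / y)%E.
Proof.
move=> r0; rewrite inveM; last by case: y => [s||] //=; rewrite gt_eqF//= ltW// implybT.
by rewrite muleACA divee ?mul1e// eqe gt_eqF.
Qed.

(** * Biased symmetric Dirichlet weights and their integrals *)

Section dirichlet.
Context {R : realType}.
Variables (t alpha : R) (n : nat).
Implicit Types (x : Rn R n) (k : 'I_n) (i : 'I_n.+1) (B : set (Rn R n)).

(* The weight of the symmetric Dirichlet law, biased by the i-th interval. *)
Definition dirichlet_weight i x : R :=
  (\prod_(l < n.+1) time_interval t x l `^ (alpha - 1)) * time_interval t x i.

Lemma measurable_dirichlet_weight i :
  measurable_fun setT (dirichlet_weight i).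
Proof.
apply: measurable_funM; last exact: measurable_time_interval.
apply: measurable_prod => l _.
apply: (@measurableT_comp _ _ _ _ _ _ (@powR R ^~ (alpha - 1))).
  exact: measurable_powR.
exact: measurable_time_interval.
Qed.

Lemma dirichlet_weight_ge0 i x : simplex t x -> 0 <= dirichlet_weight i x.
Proof.
move=> /simplexP x0; apply: mulr_ge0; last exact/ltW.
by apply: prodr_ge0 => l _; exact: powR_ge0.
Qed.

Lemma dirichlet_weight_swap_last k x :
  dirichlet_weight (widen_ord (leqnSn n) k) (swap_last t k x) =
  dirichlet_weight ord_max x.
Proof.
rewrite /dirichlet_weight time_interval_swap_last tpermL; congr (_ * _).
rewrite [RHS](reindex_inj (@perm_inj _ (last_tperm k))).
by apply: eq_bigr => l _; rewrite time_interval_swap_last.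
Qed.

Lemma simplex_swap_last k x : simplex t (swap_last t k x) <-> simplex t x.
Proof.
split => /simplexP x0; apply/simplexP => i; last by rewrite time_interval_swap_last.
by have := x0 (last_tperm k i); rewrite time_interval_swap_last tpermK.
Qed.

(** The domain enters through an indicator because [integral_swap_last] concerns integrals over the
    whole space; the indicator also removes the points where the biasing interval is negative. *)
Definition dirichlet_moment i B : \bar R :=
  (\int[lebesgue n]_x (dirichlet_weight i x * \1_(simplex t (n := n) `&` B) x)%:E)%E.

Lemma dirichlet_indic_ge0 i B x :
  0 <= dirichlet_weight i x * \1_(simplex t (n := n) `&` B) x.
Proof.
rewrite indicE; case: (boolP (x \in _)) => [/set_mem[xS _]|_]; last by rewrite mulr0.
by rewrite mulr1; exact: dirichlet_weight_ge0.
Qed.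

Lemma dirichlet_moment_swap_last k B : measurable B ->
  dirichlet_moment (widen_ord (leqnSn n) k) B =
  dirichlet_moment ord_max (swap_last t k @^-1` B).
Proof.
move=> mB; rewrite /dirichlet_moment.
rewrite -(@integral_swap_last R t n k); last 2 first.
- apply/measurable_EFinP; apply: measurable_funM.
    exact: measurable_dirichlet_weight.
  by apply: measurable_indic; apply: measurableI => //; exact: measurable_simplex.
- by move=> x; rewrite lee_fin dirichlet_indic_ge0.
apply: eq_integral => x _; rewrite dirichlet_weight_swap_last.
congr ((_ * _)%:E); rewrite !indicE; congr (nat_of_bool _)%:R.
apply/idP/idP => /set_mem[xS xB]; apply/mem_set; split => //;
  exact/(simplex_swap_last k).
Qed.

Lemma dirichlet_momentT i :
  dirichlet_moment i setT = dirichlet_moment ord_max setT.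
Proof. by move: i; apply: ord_widen_max => // k; rewrite dirichlet_moment_swap_last. Qed.

(** The constant r cancels between numerator and denominator. By [dirichlet_momentT] every bias has
    the same total mass, whence the factor [#|K|] below. *)
Lemma GD_dirichlet_moment (a b : 'I_n -> R) (r : R) (K : {set 'I_n.+1}) B :
  measurable B -> 0 < r -> (0 < #|K|)%N ->
  (forall x, simplex t x ->
    GD_weight t a b x = r * \sum_(i in K) dirichlet_weight i x) ->
  GD t a b B =
  ((\sum_(i in K) dirichlet_moment i B) /
   (#|K|%:R%:E * dirichlet_moment ord_max setT))%E.
Proof.
move=> mB r0 K0 GDE.
(* Used with C = B for the numerator and with C = [setT] for the denominator. *)
have intE C : measurable C ->
    (\int[lebesgue n]_(x in simplex t (n := n) `&` C) (GD_weight t a b x)%:E =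
     r%:E * \sum_(i in K) dirichlet_moment i C)%E.
  move=> mC; have mSC : measurable (simplex t (n := n) `&` C).
    by apply: measurableI => //; exact: measurable_simplex.
  have mf i : measurable_fun setT
      (fun x => (dirichlet_weight i x * \1_(simplex t (n := n) `&` C) x)%:E).
    apply/measurable_EFinP; apply: measurable_funM.
      exact: measurable_dirichlet_weight.
    exact: measurable_indic.
  have f0 i x : (0 <= (dirichlet_weight i x * \1_(simplex t (n := n) `&` C) x)%:E)%E.
    by rewrite lee_fin dirichlet_indic_ge0.
  rewrite -big_enum -ge0_integral_sum// -ge0_integralZl//; last 3 first.
  - exact: emeasurable_sum.
  - by move=> x _; exact: sume_ge0.
  - by rewrite lee_fin ltW.
  rewrite [LHS]integral_mkcond; apply: eq_integral => x _.
  rewrite patchE sumEFin -EFinM -mulr_suml big_enum mulrA indicE.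
  case: ifPn => [/set_mem[xS _]|_]; last by rewrite mulr0.
  by rewrite mulr1 GDE.
rewrite /GD intE// -[X in integral _ X _]setIT intE//.
have -> : (\sum_(i in K) dirichlet_moment i setT =
    #|K|%:R%:E * dirichlet_moment ord_max setT)%E.
  under eq_bigr do rewrite dirichlet_momentT.
  by rewrite [LHS]GRing.sumr_const mule_natl.
exact: mule_divM2l.
Qed.

End dirichlet.

(** * Conditional law of the position *)

Section position.
Context {R : realType} {d : nat} {dO : measure_display} {O : measurableType dO}.
Context {P : probability O R}.
Variables (M : motion P d) (c t alpha : R) (n : nat).
Variables (A : set (Rn R d)) (mA : measurable A).

Implicit Types v : n.+1.-tuple (Rn R d).

Local Notation hit v := (endpoint c t v @^-1` A).
Local Notation law := (distribution P (directions M n.+1)).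
Local Notation moment i v := (dirichlet_moment t alpha i (hit v)).

Let mhit : measurable [set z : n.+1.-tuple (Rn R d) * Rn R n | hit z.1 z.2].
Proof.
by rewrite -[X in measurable X]setTI; exact: (@measurable_endpoint R d c t n).
Qed.

Let xsection_hit v :
  xsection [set z : n.+1.-tuple (Rn R d) * Rn R n | hit z.1 z.2] v = hit v.
Proof. by rewrite xsectionE. Qed.

Let measurable_hit v : measurable (hit v).
Proof. by rewrite -xsection_hit; exact: measurable_xsection. Qed.

Lemma measurable_moment_hit i :
  measurable_fun setT (fun v : n.+1.-tuple (Rn R d) => moment i v).
Proof.
pose f (z : n.+1.-tuple (Rn R d) * Rn R n) :=
  (dirichlet_weight t alpha i z.2 * \1_(simplex t (n := n) `&` hit z.1) z.2)%:E.
have mf : measurable_fun setT f.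
  apply/measurable_EFinP; apply: measurable_funM.
    exact: measurableT_comp (@measurable_dirichlet_weight R t alpha n i) _.
  rewrite (_ : (fun z => _) =
      \1_(snd @^-1` simplex t (n := n) `&` [set z | hit z.1 z.2])); last first.
    by apply/funext => z; rewrite !indicE; congr (nat_of_bool _)%:R.
  apply: measurable_indic; apply: measurableI => //.
  rewrite -[X in measurable X]setTI; apply: measurable_snd => //.
  exact: measurable_simplex.
apply: (measurable_fun_fubini_tonelli_F f) => // z.
by rewrite lee_fin dirichlet_indic_ge0.
Qed.

Lemma moment_hit_ge0 i v : (0 <= moment i v)%E.
Proof. by apply: integral_ge0 => x _; rewrite lee_fin dirichlet_indic_ge0. Qed.

(** Exchanging the intervals turns the bias by the k-th into a bias by the last, at the cost of
    transposing two directions in v. Integration over the exchangeable directions absorbs this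
    transposition. *)
Lemma integral_moment_hit i :
  (\int[law]_v moment i v = \int[law]_v moment ord_max v)%E.
Proof.
move: i; apply: ord_widen_max => [k|]; last exact: erefl.
have ms := @measurable_permute_tuple _ (Rn R d) n.+1 (last_tperm k).
transitivity (\int[pushforward law (permute_tuple (last_tperm k))]_v moment ord_max v)%E.
  rewrite (ge0_integral_pushforward ms law measurableT
    (measurable_moment_hit _) (fun v _ => moment_hit_ge0 _ v)).
  rewrite preimage_setT; apply: eq_integral => v _.
  rewrite (dirichlet_moment_swap_last _ _ _ (measurable_hit v)).
  rewrite /comp; congr (dirichlet_moment _ _ _ _).
  by apply/seteqP; split => x /=; rewrite endpoint_swap_last.
by apply: eq_measure_integral => E mE _; exact: distribution_directions_permute.
Qed.

Lemma position_endpoint w : changes M t w = n ->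
  position c M t w = endpoint c t (directions M n.+1 w) (duration M t n w).
Proof.
rewrite /position => ->; apply: eq_from_tnth => i; rewrite !tnth_mktuple.
by congr (_ * _); apply: eq_bigr => k _; rewrite tnth_mktuple.
Qed.

(** Integrating over the directions makes the [#|K|] terms of the numerator equal, and this count
    cancels with the one in the denominator. The right side thus involves neither r nor K. *)
Lemma cond_prob_position (a b : forall n, 'I_n -> R) (r : R) (K : {set 'I_n.+1}) :
  has_GD_durations M a b -> 0 < t -> (1 <= n)%N ->
  (0 < P (changes M t @^-1` [set n]))%E -> 0 < r -> (0 < #|K|)%N ->
  (forall x, simplex t x -> GD_weight t (a n) (b n) x =
    r * \sum_(i in K) dirichlet_weight t alpha i x) ->
  cond_prob P (changes M t @^-1` [set n]) (position c M t @^-1` A) =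
  ((\int[law]_v moment ord_max v) / dirichlet_moment t alpha (@ord_max n) setT)%E.
Proof.
move=> GDM t0 n0 Pn r0 K0 GDE.
have -> : cond_prob P (changes M t @^-1` [set n]) (position c M t @^-1` A) =
    cond_prob P (changes M t @^-1` [set n])
      [set w | hit (directions M n.+1 w) (duration M t n w)].
  congr (P _ / _)%E; apply/seteqP; split => w [] /= wA wn; split => //.
    by rewrite -position_endpoint.
  by rewrite position_endpoint.
have ind : independent3 P (directions M n.+1) (duration M t n) (changes M t).
  exact: motion_independent.
rewrite (cond_prob_pair ind mhit _ Pn)//.
under eq_integral do rewrite xsection_hit GDM// (GD_dirichlet_moment _ r0 K0 GDE)//.
have D0 : (0 <= (#|K|%:R%:E * dirichlet_moment t alpha (@ord_max n) setT)^-1)%E.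
  rewrite inve_ge0 mule_ge0// integral_ge0// => x _.
  by rewrite lee_fin dirichlet_indic_ge0.
have mm i := measurable_moment_hit i.
rewrite ge0_integralZr//; last 2 first.
- by under eq_fun do rewrite -big_enum; exact: emeasurable_sum.
- by move=> v _; apply: sume_ge0 => i _; exact: moment_hit_ge0.
under eq_integral do rewrite -big_enum.
rewrite ge0_integral_sum//; last by move=> i v _; exact: moment_hit_ge0.
under eq_bigr do rewrite integral_moment_hit.
rewrite big_enum
  [X in (X / _)%E](_ : _ = #|K|%:R%:E * \int[law]_v moment ord_max v)%E.
  by rewrite mule_divM2l// ltr0n.
by rewrite [LHS]GRing.sumr_const mule_natl.
Qed.

End position.

(** * Generalized Dirichlet weights as biased symmetric ones *)

Section biased_dirichlet.
Context {R : realType}.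
Variables (t alpha : R).

(* On the simplex, the density of GD(a; b) is proportional to that of the symmetric
   Dirichlet law biased by the total length of the intervals in some set K. *)
Definition biased_dirichlet n (a b : 'I_n -> R) :=
  exists (r : R) (K : {set 'I_n.+1}), [/\ 0 < r, (0 < #|K|)%N &
    forall x, simplex t x ->
      GD_weight t a b x = r * \sum_(i in K) dirichlet_weight t alpha i x].

(** Here e is the excess of b over (1, ..., 1, alpha). The last factor of [GD_weight] has the last
    interval as its base, so its power alpha - 1 completes the symmetric product over all n + 1
    intervals. *)
Lemma GD_weight_factor n (b e : 'I_n -> R) (x : Rn R n) :
  (1 <= n)%N -> simplex t x ->
  (forall k, b k - 1 = (if k.+1 == n then alpha - 1 else 0) + e k) ->
  GD_weight t (fun=> alpha) b x =
  (\prod_(l < n.+1) time_interval t x l `^ (alpha - 1)) *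
  \prod_(k < n) (\sum_(i < n.+1 | (k < i)%N) time_interval t x i) `^ e k.
Proof.
move=> n0 /simplexP x0 be; rewrite /GD_weight big_split /= big_ord_recr /= -mulrA.
congr (_ * _); first by apply: eq_bigr => k _; rewrite time_interval_widen.
case: n n0 b e x x0 be => // n _ b e x x0 be.
(* The power of the last interval is spread over all k, with exponent 0 except at the last k, to be
   merged factor by factor with the powers [e k]. *)
have -> : time_interval t x ord_max `^ (alpha - 1) =
    \prod_(k < n.+1) (\sum_(i < n.+2 | (k < i)%N) time_interval t x i) `^
      (if k.+1 == n.+1 then alpha - 1 else 0).
  rewrite big_ord_recr /= eqxx big1 ?mul1r => [|k _].
    rewrite (big_pred1 ord_max)// => i /=.
    by rewrite -val_eqE /= eqn_leq (leq_ord i).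
  by rewrite eqSS (ltn_eqF (ltn_ord k)) powRr0.
rewrite -big_split; apply: eq_bigr => k _ /=.
(* Adding exponents requires a nonzero base: each sum contains the last interval, which is
   positive. *)
rewrite sum_time_interval_gt be powRD//; apply/implyP => _; apply: lt0r_neq0.
rewrite (bigD1 ord_max) ?ltn_ord//=; apply: ltr_wpDr => //.
by apply: sumr_ge0 => i _; exact/ltW.
Qed.

Lemma biased_dirichletT n (b : 'I_n -> R) : 0 < t -> (1 <= n)%N ->
  (forall k, b k = if k.+1 == n then alpha else 1) ->
  biased_dirichlet (fun=> alpha) b.
Proof.
(* With no excess the weight is unbiased; the sum of all intervals is t, which the constant 1/t
   compensates. *)
move=> t0 n0 bE; exists t^-1, [set: 'I_n.+1]%SET; split; first by rewrite invr_gt0.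
  by rewrite cardsT card_ord.
move=> x xS; rewrite (@GD_weight_factor _ b (fun=> 0))// => [|k]; last first.
  by rewrite bE addr0; case: ifP; rewrite ?subrr.
rewrite -mulr_sumr [X in _ * (_ * X)](eq_bigl xpredT) => [|i]; last first.
  by rewrite finset.in_setT.
rewrite sum_time_interval mulrCA mulVf ?gt_eqF// mulr1.
by rewrite [X in _ * X]big1 ?mulr1// => k _; rewrite powRr0.
Qed.

Lemma biased_dirichlet_gt n (b : 'I_n -> R) (k0 : 'I_n) : (1 <= n)%N ->
  (forall k, b k = (if k.+1 == n then alpha else 1) + (k == k0)%:R) ->
  biased_dirichlet (fun=> alpha) b.
Proof.
(* The unit excess at k0 contributes, to the power 1, the sum of the intervals after k0. *)
move=> n0 bE; exists 1, [set i : 'I_n.+1 | (k0 < i)%N]%SET; split => //.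
  by apply/card_gt0P; exists ord_max; rewrite finset.in_set /= ltn_ord.
move=> x xS; rewrite (@GD_weight_factor _ b (fun k => (k == k0)%:R))// => [|k]; last first.
  by rewrite bE addrAC; case: ifP; rewrite ?subrr.
rewrite mul1r -mulr_sumr; congr (_ * _).
rewrite (bigD1 k0) //= eqxx powRr1; last first.
  by apply: sumr_ge0 => i _; apply/ltW; move/simplexP: xS.
rewrite [X in _ * X]big1 ?mulr1 => [|k /negPf ->]; last by rewrite powRr0.
by apply: eq_bigl => i; rewrite finset.in_set.
Qed.

End biased_dirichlet.

(** * Comparison of two motions, and the three processes *)

Lemma same_conditional_positions_biased_dirichlet (R : realType) (c alpha : R)
    (d : nat) (d1 d2 : measure_display)
    (O1 : measurableType d1) (O2 : measurableType d2)
    (P1 : probability O1 R) (P2 : probability O2 R)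
    (M1 : motion P1 d) (M2 : motion P2 d) (a1 b1 a2 b2 : forall n, 'I_n -> R) :
  has_GD_durations M1 a1 b1 -> has_GD_durations M2 a2 b2 ->
  (forall t n, 0 < t -> (1 <= n)%N -> biased_dirichlet t alpha (a1 n) (b1 n)) ->
  (forall t n, 0 < t -> (1 <= n)%N -> biased_dirichlet t alpha (a2 n) (b2 n)) ->
  same_conditional_positions c M1 M2.
Proof.
move=> GD1 GD2 bias1 bias2 t n t0 n0 N1 N2 A mA.
have [r1 [K1 [r10 K10 w1]]] := bias1 t n t0 n0.
have [r2 [K2 [r20 K20 w2]]] := bias2 t n t0 n0.
rewrite (cond_prob_position c mA GD1 t0 n0 N1 r10 K10 w1).
rewrite (cond_prob_position c mA GD2 t0 n0 N2 r20 K20 w2).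
(* With alpha common to both, the motions enter only through the joint law of their directions,
   which is the same. *)
congr (_ / _)%E; apply: eq_measure_integral => E mE _.
exact: distribution_directions_unique.
Qed.

Theorem theorem6 (R : realType) (c : R) (j h d : nat)
    (hc : 0 < c) (hj : (1 <= j)%N) (hh : h = 1%N \/ h = 2%N)
    (hd1 : h = 1%N -> (2 <= d)%N) (hd2 : h = 2%N -> (3 <= d)%N)
    (e0 e1 e2 : measure_display)
    (O0 : measurableType e0) (O1 : measurableType e1) (O2 : measurableType e2)
    (P0 : probability O0 R) (P1 : probability O1 R) (P2 : probability O2 R)
    (Y0 : motion P0 d) (Y1 : motion P1 d) (Z : motion P2 d) :
  is_Y h 0 Y0 -> is_Y h 1 Y1 -> is_Z h j Z ->
  [/\ same_conditional_positions c Y0 Y1,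
      same_conditional_positions c Y0 Z
    & same_conditional_positions c Y1 Z].
Proof.
pose alpha : R := d%:R / h%:R - 1.
move=> isY0 isY1 isZ.
have bY0 (t : R) n : 0 < t -> (1 <= n)%N -> biased_dirichlet t alpha
    (fun=> alpha) (fun k : 'I_n => if k.+1 == n then d%:R / h%:R - 0%:R else 1).
  (* Since d/h = alpha + 1, the excess sits at the last coordinate and the bias is by the last
     interval alone. *)
  case: n => // n t0 n0; apply: (@biased_dirichlet_gt _ _ _ _ _ ord_max) => // k.
  by rewrite -val_eqE /= eqSS; case: eqP => _; rewrite ?addr0// subr0 subrK.
have bY1 (t : R) n : 0 < t -> (1 <= n)%N -> biased_dirichlet t alpha
    (fun=> alpha) (fun k : 'I_n => if k.+1 == n then d%:R / h%:R - 1%:R else 1).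
  by move=> t0 n0; exact: biased_dirichletT.
have bZ (t : R) n : 0 < t -> (1 <= n)%N -> biased_dirichlet t alpha
    (fun=> alpha) (fun k : 'I_n => if k.+1 == n then d%:R / h%:R - 1
      else if (j <= n.-1)%N && (k.+1 == j) then 2 else 1).
  (* Here n is one less than the number of changes. If j exceeds it, no coordinate gets the value 2
     and there is no excess; otherwise the excess is at the j-th coordinate, whose ordinal is j -
     1. *)
  case: n => // n t0 n0; have [jn|nj] := leqP j n; last first.
    by apply: biased_dirichletT => // k.
  have j0 : (j.-1 < n.+1)%N by rewrite prednK// ltnW.
  apply: (@biased_dirichlet_gt _ _ _ _ _ (Ordinal j0)) => // k.
  rewrite -val_eqE /= (_ : (val k == j.-1) = (k.+1 == j)) ?eqSS; last first.
    by rewrite -eqSS prednK.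
  (* The j-th coordinate is not the last one, so the last value stays alpha; elsewhere 2 = 1 + 1. *)
  case: eqP => [kn|_]; last by case: eqP => _; rewrite ?addr0// -natrD.
  by rewrite kn (gtn_eqF _) ?addr0// ltnS.
split.
- exact: same_conditional_positions_biased_dirichlet isY0 isY1 bY0 bY1.
- exact: same_conditional_positions_biased_dirichlet isY0 isZ bY0 bZ.
- exact: same_conditional_positions_biased_dirichlet isY1 isZ bY1 bZ.
Qed.
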